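(* Let $n\ge1$, let $J\in\mathbb{C}^{n\times n}$ satisfy $J=J^*=J^{-1}$ and have inertia $(n-q,q)$ (that is, $n-q$ eigenvalues equal to $1$ and $q$ eigenvalues equal to $-1$, counted with multiplicity). Let $A\in\mathbb{C}^{n\times n}$ satisfy $A^*J=JA$ and $\sigma(A)\subset\{z\in\mathbb{C}:|z|\le 1\}$, and suppose additionally that $\rho(A)<\gamma<1$. Then, for every integer $k\ge1$, $$\|A^k\|_2\le\nu_J(A)\left(1+\frac1k\right)^k\mathcal{K}_\gamma(A)\,\gamma^k\le e\,\nu_J(A)\,\mathcal{K}_\gamma(A)\,\gamma^k.$$
   Context: $\|\cdot\|_2$ is the spectral norm; $\sigma(A)$ and $\rho(A)$ are the spectrum and spectral radius of $A$. For $\rho(A)<\gamma$, define $\mathcal{K}_\gamma(A):=\sup_{|z|>\gamma}(|z|-\gamma)\|(zI-A)^{-1}\|_2$. Let $d(A)$ be the degree of the minimal polynomial of $A$. With $q$ the number of negative eigenvalues of $J$, set $\nu_J(A):=\min\{d(A),\,2q+1,\,2(n-q)+1\}$. *)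

(* Defs.v *)
From mathcomp Require Import all_boot all_order all_algebra.
From mathcomp Require Import all_classical all_reals all_analysis.
From mathcomp Require Import complex.

Set Implicit Arguments.
Unset Strict Implicit.
Unset Printing Implicit Defensive.

Import Order.TTheory GRing.Theory Num.Theory.

Local Open Scope classical_set_scope.
Local Open Scope complex_scope.
Local Open Scope ring_scope.

(* The order and the norm of [R[i]] take values in [R[i]]; [cabs] is the
   modulus as an element of [R]. *)
Definition cabs (R : realType) (z : R[i]) : R := Normc.normc z.

Definition vnorm2 (R : realType) n (x : 'cV[R[i]]_n) : R :=
  Num.sqrt (\sum_(i < n) cabs (x i 0) ^+ 2).

Definition spectral_norm (R : realType) m n (A : 'M[R[i]]_(m, n)) : R :=
  sup [set vnorm2 (A *m x) | x in [set x : 'cV[R[i]]_n | vnorm2 x <= 1]].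

(* [eigenvalue] is stated with row eigenvectors; for a square matrix this gives
   the same set as column eigenvectors. *)
Definition spectrum (R : realType) n (A : 'M[R[i]]_n) : set R[i] :=
  [set z | eigenvalue A z].

Definition spectral_radius (R : realType) n (A : 'M[R[i]]_n) : R :=
  sup [set cabs z | z in spectrum A].

(* Real supremum: the set is bounded above as soon as spectral_radius A < gamma,
   the only case in which the constant is meaningful. *)
Definition kreiss_const (R : realType) n (gamma : R) (A : 'M[R[i]]_n) : R :=
  sup [set (cabs z - gamma) * spectral_norm (invmx (z%:M - A))
      | z in [set z : R[i] | gamma < cabs z]].

(* Roots of the (monic) characteristic polynomial, listed with multiplicity. *)
Definition eigenvalues_seq (R : realType) n (A : 'M[R[i]]_n) : seq R[i] :=
  sval (closed_field_poly_normal (char_poly A)).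

(* In [R[i]], [0 < z] and [z < 0] entail that [z] is real. *)
Definition npos_eig (R : realType) n (H : 'M[R[i]]_n) : nat :=
  count (fun z => 0 < z) (eigenvalues_seq H).

Definition nneg_eig (R : realType) n (H : 'M[R[i]]_n) : nat :=
  count (fun z => z < 0) (eigenvalues_seq H).

Definition inertia (R : realType) n (H : 'M[R[i]]_n) : nat * nat :=
  (npos_eig H, nneg_eig H).

(* Matrices of size n.+1, for which the minimal polynomial is defined in the
   library; [degree_mxminpoly A] is its degree. *)
Definition nuJ (R : realType) n (J A : 'M[R[i]]_n.+1) : nat :=
  minn (degree_mxminpoly A)
    (minn (2 * nneg_eig J + 1) (2 * (n.+1 - nneg_eig J) + 1)).

(* Main.v *)
Require Import Defs.
From mathcomp Require Import all_boot all_order all_algebra.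
From mathcomp Require Import all_classical all_reals all_analysis.
From mathcomp Require Import complex.
From mathcomp Require Import separable cyclotomic cyclic ring lra zify.

(* Since [J A^k] is Hermitian, it suffices to bound the moments [v* J A^k v].
   Scale [A] to [T = A/r] with [r = gamma (1 + 1/k)]; the Kreiss constant bounds
   the resolvent of [T] on the unit circle by [s].  The Hankel matrix [G] of the
   moments [v* J T^(a+b) v] then satisfies:
   - its eigenvalues are at most [s |v|^2] in modulus (Nehari);
   - its rank is at most the degree of the minimal polynomial of [A] (Kronecker);
   - by Sylvester's law it has at most [q] negative and [n - q] positive
     eigenvalues;
   - its trace is [v* J (1 - T^2)^-1 v], half the difference of the values at [1]
     and [-1] of the resolvent form, hence at most [s |v|^2] in modulus.
   So the trace norm of [G] is at most [nu_J(A) s |v|^2].  Pairing [G] with the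
   flip supported on the [k]-th antidiagonal yields [(k + 1) v* J T^k v], hence
   [(k + 1) |v* J T^k v| <= nu_J(A) s |v|^2]; the choice of [r] makes this the
   claimed bound.  To stay within finite sums, the moments are periodized:
   [T^i] is replaced by [T^i (1 - T^(2p))^-1], and [p] tends to infinity. *)

Set Implicit Arguments.
Unset Strict Implicit.
Unset Printing Implicit Defensive.

Import Order.TTheory GRing.Theory Num.Theory.

Local Open Scope sesquilinear_scope.
Local Open Scope ring_scope.

(** * Hermitian forms and ranks *)

Lemma adjmxM (C : numClosedFieldType) m n p (M : 'M[C]_(m, n))
    (N : 'M[C]_(n, p)) : (M *m N) ^t* = N ^t* *m M ^t*.
Proof. by rewrite trmx_mul map_mxM. Qed.

Lemma adjmxE (C : numClosedFieldType) m n (M : 'M[C]_(m, n)) i j :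
  (M ^t*) i j = (M j i)^*.
Proof. by rewrite !mxE. Qed.

Lemma exists_kernel_col (F : fieldType) m p (M : 'M[F]_(m, p)) :
  (\rank M < p)%N -> exists2 c : 'cV[F]_p, c != 0 & M *m c = 0.
Proof.
move=> rM; have : kermx M^T != 0.
  by rewrite -mxrank_eq0 mxrank_ker mxrank_tr -lt0n subn_gt0.
case/rowV0Pn => v /sub_kermxP vM0 vN0; exists v^T.
  by rewrite trmx_eq0.
by apply: (can_inj trmxK); rewrite trmx_mul trmxK vM0 trmx0.
Qed.

Lemma rank_diag_mx_le (F : fieldType) p (d : 'rV[F]_p) :
  (\rank (diag_mx d) <= #|[pred i | d 0%R i != 0%R]|)%N.
Proof.
have -> : diag_mx d = \sum_(i | d 0 i != 0) d 0 i *: delta_mx i i.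
  apply/matrixP=> i j; rewrite summxE !mxE.
  case: (eqVneq i j) => [->|ij] /=.
    case: (eqVneq (d 0 j) 0) => [dj0|djN0].
      rewrite big1 ?dj0 // => l dl; rewrite !mxE.
      by case: (eqVneq j l) => [<-|_]; rewrite ?dj0 ?mul0r ?mulr0.
    rewrite (bigD1 j) //= !mxE !eqxx mulr1 big1 ?addr0 // => l /andP[_ lj].
    by rewrite !mxE eq_sym (negPf lj) mulr0.
  rewrite mulr0n big1 // => l _; rewrite !mxE.
  case: (eqVneq i l) => [<-|_]; rewrite ?mulr0 //=.
  by rewrite eq_sym (negPf ij) mulr0.
rewrite -sum1_card.
elim/big_ind2: _ => [|a M b N ha hb|i _]; first by rewrite mxrank0.
  exact: leq_trans (mxrank_add _ _) (leq_add ha hb).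
by rewrite (leq_trans (mxrank_scale _ _)) // mxrank_delta.
Qed.

(** With [0^-1 = 0], the product of [diag_mx d] and [diag_mx e] is the projector onto the nonzero
    entries and [diag_mx z] is the complementary one. They add up to the identity, so rank
    subadditivity turns the upper bound for [z] into a lower bound for [d]. *)
Lemma rank_diag_mx_ge (F : fieldType) p (d : 'rV[F]_p) :
  (#|[pred i | d 0%R i != 0%R]| <= \rank (diag_mx d))%N.
Proof.
pose e : 'rV[F]_p := \row_i (d 0 i)^-1.
pose z : 'rV[F]_p := \row_i (d 0 i == 0)%:R.
have E : diag_mx d *m diag_mx e + diag_mx z = 1%:M.
  rewrite mulmx_diag; apply/matrixP=> i j; rewrite !mxE -mulrnDl.
  case: (eqVneq (d 0 i) 0) => [->|dN0]; rewrite ?mul0r ?add0r // ?divff // ?addr0 //.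
have le1 : (p <= \rank (diag_mx d) + \rank (diag_mx z))%N.
  rewrite -[X in (X <= _)%N](mxrank1 F) -E (leq_trans (mxrank_add _ _)) // leq_add2r.
  exact: mxrankM_maxl.
have := rank_diag_mx_le z.
have -> : #|[pred i | z 0%R i != 0%R]| = #|[predC [pred i | d 0%R i != 0%R]]|.
  apply: eq_card => i; rewrite !inE !mxE negbK.
  by case: (d 0 i == 0); rewrite ?oner_eq0 ?eqxx.
have := cardC [pred i | d 0%R i != 0%R]; rewrite card_ord => cC lez.
rewrite -(leq_add2r #|[predC [pred i | d 0%R i != 0%R]]|).
by rewrite [X in (X <= _)%N]cC (leq_trans le1) // leq_add2l.
Qed.

Definition dotc (C : numClosedFieldType) n (x y : 'cV[C]_n) : C :=
  (x ^t* *m y) 0 0.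

Section Dot.
Variables (C : numClosedFieldType) (n : nat).
Implicit Types x y z : 'cV[C]_n.

Lemma dotcE x y : dotc x y = \sum_i (x i 0)^* * y i 0.
Proof. by rewrite /dotc mxE; apply: eq_bigr => i _; rewrite !mxE. Qed.

Lemma dotc_self x : dotc x x = \sum_i `|x i 0| ^+ 2.
Proof. by rewrite dotcE; apply: eq_bigr => i _; rewrite normCKC. Qed.

Lemma dotc_ge0 x : 0 <= dotc x x.
Proof. by rewrite dotc_self sumr_ge0 // => i _; rewrite exprn_ge0. Qed.

Lemma dotcC x y : (dotc x y)^* = dotc y x.
Proof.
rewrite !dotcE rmorph_sum; apply: eq_bigr => i _.
by rewrite rmorphM /= conjCK mulrC.
Qed.

Lemma dotcDl x y z : dotc (x + y) z = dotc x z + dotc y z.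
Proof. by rewrite /dotc linearD /= map_mxD mulmxDl mxE. Qed.

Lemma dotcDr x y z : dotc z (x + y) = dotc z x + dotc z y.
Proof. by rewrite /dotc mulmxDr mxE. Qed.

Lemma dotcZl a x y : dotc (a *: x) y = a^* * dotc x y.
Proof. by rewrite /dotc linearZ /= map_mxZ -scalemxAl mxE. Qed.

Lemma dotcZr a x y : dotc y (a *: x) = a * dotc y x.
Proof. by rewrite /dotc -scalemxAr mxE. Qed.

Lemma dotcNl x y : dotc (- x) y = - dotc x y.
Proof. by rewrite -scaleN1r dotcZl rmorphN1 mulN1r. Qed.

Lemma dotcNr x y : dotc y (- x) = - dotc y x.
Proof. by rewrite -scaleN1r dotcZr mulN1r. Qed.

(** Entrywise this is [t^-1 * (t * a - b) ^+ 2 >= 0]. The free weight [t] makes it a substitute for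
    the Cauchy-Schwarz inequality that involves no square roots. *)
Lemma dotc_le x y t : 0 < t ->
  `|dotc x y| <= (t * dotc x x + t^-1 * dotc y y) / 2.
Proof.
move=> t0; rewrite dotcE !dotc_self !mulr_sumr -big_split /= mulr_suml.
rewrite (le_trans (ler_norm_sum _ _ _)) // ler_sum // => i _.
rewrite normrM norm_conjC ler_pdivlMr ?ltr0n //.
set a := `|x i 0|; set b := `|y i 0|.
have a0 : a \is Num.real by exact: normr_real.
have b0 : b \is Num.real by exact: normr_real.
have tr : t \is Num.real by exact: gtr0_real.
have : 0 <= t^-1 * (t * a - b) ^+ 2.
  by rewrite mulr_ge0 ?invr_ge0 ?(ltW t0) // real_exprn_even_ge0 // rpredB ?rpredM.
have tN0 : t != 0 by rewrite gt_eqF.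
move=> h; rewrite -subr_ge0.
by have -> : t * a ^+ 2 + t^-1 * b ^+ 2 - a * b * 2 = t^-1 * (t * a - b) ^+ 2 by field.
Qed.
End Dot.

Lemma dotcMl (C : numClosedFieldType) m n (M : 'M[C]_(m, n)) x y :
  dotc (M *m x) y = dotc x (M ^t* *m y).
Proof. by rewrite /dotc adjmxM mulmxA. Qed.

(** The weight [t = s] in [dotc_le] makes both halves of the mean at most [s * dotc x x]. *)
Lemma dotc_resolvent_le (C : numClosedFieldType) n (x y : 'cV[C]_n) s : 0 < s ->
  dotc y y <= s ^+ 2 * dotc x x -> `|dotc x y| <= s * dotc x x.
Proof.
move=> s0 h; apply: le_trans (dotc_le x y s0) _.
rewrite ler_pdivrMr ?ltr0n // mulr_natr mulr2n lerD2l.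
rewrite -ler_pdivlMl ?invr_gt0 // invrK mulrA -expr2 //.
Qed.

(* Polarization at [x] and [c^-1 *: H *m x]. *)
Lemma hermitian_form_bound (C : numClosedFieldType) n (H : 'M[C]_n) c : 0 < c ->
  H ^t* = H -> (forall v, `|dotc v (H *m v)| <= c * dotc v v) ->
  forall x, dotc (H *m x) (H *m x) <= c ^+ 2 * dotc x x.
Proof.
move=> c0 hH hb x; set y := H *m x; set t := c^-1.
have t0 : 0 < t by rewrite invr_gt0.
have tC : t^* = t by rewrite conj_Creal ?gtr0_real.
have xHy : dotc x (H *m y) = dotc y y by rewrite -{1}hH -dotcMl.
have key : dotc (x + t *: y) (H *m (x + t *: y)) -
   dotc (x - t *: y) (H *m (x - t *: y)) = 4 * t * dotc y y.
  rewrite !mulmxDr mulmxN -!scalemxAr -/y.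
  rewrite !(dotcDl, dotcDr, dotcNl, dotcNr, dotcZl, dotcZr) tC xHy.
  ring.
have le0 := hb (x + t *: y); have le1 := hb (x - t *: y).
have : `|4 * t * dotc y y| <= c * (2 * dotc x x + 2 * t ^+ 2 * dotc y y).
  rewrite -key (le_trans (ler_normB _ _)) // (le_trans (lerD le0 le1)) //.
  rewrite !(dotcDl, dotcDr, dotcNl, dotcNr, dotcZl, dotcZr) tC -mulrDr.
  by rewrite le_eqVlt; apply/orP; left; apply/eqP; ring.
have yy0 : 0 <= dotc y y by exact: dotc_ge0.
rewrite ger0_norm ?mulr_ge0 ?ler0n ?(ltW t0) //.
(* Since [c * t = 1], the [dotc y y] term on the right is half of the left side and gets
   absorbed. *)
have -> : c * (2 * dotc x x + 2 * t ^+ 2 * dotc y y) =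
    2 * c * dotc x x + 2 * (t * dotc y y).
  have -> : c * (2 * dotc x x + 2 * t ^+ 2 * dotc y y) =
    2 * c * dotc x x + 2 * (c * t * (t * dotc y y)) by ring.
  by rewrite /t divff ?gt_eqF // mul1r.
have -> : 4 * t * dotc y y = 2 * (t * dotc y y) + 2 * (t * dotc y y) by ring.
rewrite lerD2r -mulrA ler_pM2l ?ltr0n // /t ler_pdivrMl // mulrA.
by rewrite expr2.
Qed.

(** * Trace norms of Hermitian matrices *)

Lemma hermitian_spectral (C : numClosedFieldType) p (G : 'M[C]_p) :
  G ^t* = G -> exists P : 'M[C]_p, exists2 d : 'rV[C]_p,
    P *m P ^t* = 1%:M & (forall i, d 0 i \is Num.real) /\
    G = P ^t* *m diag_mx d *m P.
Proof.
move=> hG; have hG' : G \is hermsymmx.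
  by apply/is_hermitianmxP; rewrite expr0 scale1r hG.
exists (spectralmx G), (spectral_diag G).
  exact/unitarymxP/spectral_unitarymx.
split=> [i|]; first exact: (mxOverP (hermitian_spectral_diag_real hG')).
have /orthomx_spectralP {1}-> := hermitian_normalmx hG'.
by rewrite invmx_unitary ?spectral_unitarymx.
Qed.

Lemma sum_antidiag_le1 (C : numDomainType) p a k :
  \sum_(b < p) (a + b == k)%N%:R <= 1 :> C.
Proof.
have [h|h] := boolP [exists b : 'I_p, (a + b == k)%N]; last first.
  by rewrite big1 ?ler01 // => b _; move/existsPn: h => /(_ b)/negPf ->.
case/existsP: h => b0 hb0; rewrite (bigD1 b0) //= hb0 big1 ?addr0 // => b bb0.
by rewrite -(eqP hb0) eqn_add2l val_eqE (negPf bb0).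
Qed.

Section SpectralSums.
Variables (C : numClosedFieldType) (p : nat) (P : 'M[C]_p) (d : 'rV[C]_p).
Hypothesis PP : P *m P ^t* = 1%:M.
Hypothesis dreal : forall i, d 0 i \is Num.real.
Let G := P ^t* *m diag_mx d *m P.

Lemma spectral_quad_form x :
  dotc x (G *m x) = \sum_i d 0 i * `|(P *m x) i 0| ^+ 2.
Proof.
rewrite /G -!mulmxA -dotcMl dotcE; apply: eq_bigr => i _.
by rewrite mul_diag_mx [X in _ * X]mxE mulrCA normCKC.
Qed.

(** The form is tested on the unit eigenvector for the [i]-th diagonal entry, namely column [i] of
    the adjoint of [P]. *)
Lemma spectral_value_le c : (forall x, `|dotc x (G *m x)| <= c * dotc x x) ->
  forall i, `|d 0 i| <= c.
Proof.
move=> h i; have := h (P ^t* *m delta_mx i 0).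
rewrite spectral_quad_form mulmxA PP mul1mx dotcMl trmxCK mulmxA PP mul1mx.
have sumE (w : 'I_p -> C) : \sum_j w j * `|(delta_mx i 0 : 'cV[C]_p) j 0| ^+ 2 = w i.
  rewrite (bigD1 i) //= !mxE !eqxx normr1 expr1n mulr1 big1 ?addr0 // => j ji.
  by rewrite !mxE (negPf ji) normr0 expr0n mulr0.
have -> : dotc (delta_mx i 0 : 'cV[C]_p) (delta_mx i 0) = 1.
  by rewrite dotc_self -(sumE (fun=> 1)); apply: eq_bigr => j _; rewrite mul1r.
by rewrite sumE mulr1.
Qed.

Lemma unitary_row_sum i : \sum_a `|P i a| ^+ 2 = 1.
Proof.
have /matrixP/(_ i i) := PP; rewrite !mxE eqxx mulr1n => <-.
by apply: eq_bigr => a _; rewrite !mxE normCK.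
Qed.

(* The flip [e_a |-> e_(k - a)] is a contraction, so pairing it with [G] costs
   at most the trace norm of [G]. *)
Lemma antidiag_sum_le k :
  `|\sum_(a < p) \sum_(b < p) (a + b == k)%N%:R * G a b| <= \sum_i `|d 0 i|.
Proof.
have GE a b : G a b = \sum_i d 0 i * ((P i a)^* * P i b).
  rewrite /G mul_mx_diag mxE; apply: eq_bigr => i _.
  by rewrite !mxE; ring.
have -> : \sum_(a < p) \sum_(b < p) (a + b == k)%N%:R * G a b =
    \sum_i d 0 i * \sum_(a < p) \sum_(b < p) (a + b == k)%N%:R * ((P i a)^* * P i b).
  under eq_bigr => a _ do under eq_bigr => b _ do rewrite GE mulr_sumr.
  under eq_bigr => a _ do rewrite exchange_big.
  rewrite exchange_big /=; apply: eq_bigr => i _.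
  rewrite mulr_sumr; apply: eq_bigr => a _; rewrite mulr_sumr.
  by apply: eq_bigr => b _; rewrite mulrCA.
rewrite (le_trans (ler_norm_sum _ _ _)) // ler_sum // => i _.
rewrite normrM ler_piMr //.
pose f a b : C := (a + b == k)%N%:R.
have f0 a b : 0 <= f a b by rewrite ler0n.
(* The flip has at most one unit entry in each row and column, so each of the two squares
   contributes at most the squared norm of row [i] of [P], which is 1. *)
have : \sum_(a < p) \sum_(b < p) f a b * (`|P i a| ^+ 2 + `|P i b| ^+ 2) <= 2.
  under eq_bigr => a _ do under eq_bigr => b _ do rewrite mulrDr.
  under eq_bigr => a _ do rewrite big_split.
  rewrite big_split /= -natr1 lerD //.
    rewrite -(unitary_row_sum i) ler_sum // => a _.
    by rewrite -mulr_suml ler_piMl ?exprn_ge0 ?sum_antidiag_le1.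
  rewrite exchange_big /= -(unitary_row_sum i) ler_sum // => a _.
  rewrite -mulr_suml ler_piMl ?exprn_ge0 //.
  under eq_bigr do rewrite /f addnC.
  exact: sum_antidiag_le1.
move=> h; rewrite -(ler_pM2r (ltr0n C 2)) mul1r (le_trans _ h) //.
rewrite -ler_pdivlMr ?ltr0n // (le_trans (ler_norm_sum _ _ _)) //.
rewrite mulr_suml ler_sum // => a _.
rewrite (le_trans (ler_norm_sum _ _ _)) // mulr_suml ler_sum // => b _.
rewrite normrM (ger0_norm (f0 _ _)) -mulrA ler_wpM2l //.
rewrite normrM norm_conjC ler_pdivlMr ?ltr0n // mulr_natr.
by have [] := real_leif_mean_square_scaled (normr_real (P i a)) (normr_real (P i b)).
Qed.

Lemma rank_spectral : (#|[pred i | d 0%R i != 0%R]| <= \rank G)%N.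
Proof.
rewrite (leq_trans (rank_diag_mx_ge _)) //.
have -> : diag_mx d = P *m G *m P ^t*.
  by rewrite /G !mulmxA PP mul1mx -mulmxA PP mulmx1.
by rewrite (leq_trans (mxrankM_maxl _ _)) // mxrankM_maxr.
Qed.

(* Sylvester: a negative definite subspace of dimension larger than [\rank K]
   would meet the kernel of [K]. *)
Lemma negative_count n m (H : 'M[C]_n) (X : 'M[C]_(n, p)) (K : 'M[C]_(m, n)) :
    G = X ^t* *m H *m X ->
    (forall y : 'cV_n, K *m y = 0 -> 0 <= dotc y (H *m y)) ->
  (#|[pred i | (d 0 i < 0)%R]| <= \rank K)%N.
Proof.
move=> GE Hpos; rewrite leqNgt; apply/negP => ltK.
(* The kernel of [diag_mx e] consists of the coordinate vectors supported on the negative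
   eigenvalues. *)
pose e : 'rV[C]_p := \row_i (~~ (d 0 i < 0))%:R.
have re : (\rank (diag_mx e) <= p - #|[pred i | (d 0 i < 0)%R]|)%N.
  apply: leq_trans (rank_diag_mx_le _) _.
  rewrite leq_subRL ?max_card //; last by rewrite -[p in (_ <= p)%N]card_ord max_card.
  rewrite -[X in (_ <= X)%N]card_ord -(cardC [pred i | (d 0 i < 0)%R]) leq_add2l.
  apply: subset_leq_card; apply/fintype.subsetP => i; rewrite !inE !mxE.
  by case: (d 0 i < 0); rewrite ?eqxx.
(* Stacking both families of linear constraints still leaves rank below [p], so a nonzero [c]
   satisfies all of them. The form is then nonnegative at its image by [Hpos], yet negative by the
   support of [c]. *)
have rM : (\rank (col_mx (K *m (X *m P ^t*)) (diag_mx e)) < p)%N.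
  rewrite -addsmxE (leq_ltn_trans (mxrank_adds_leqif _ _)) //.
  have lep : (#|[pred i | (d 0 i < 0)%R]| <= p)%N.
    by rewrite -[p in (_ <= p)%N]card_ord max_card.
  rewrite (@leq_ltn_trans (\rank K + (p - #|[pred i | (d 0 i < 0)%R]|))%N) //.
    by rewrite leq_add // mxrankM_maxl.
  by rewrite addnC -ltn_subRL subKn.
case: (exists_kernel_col rM) => c cN0; rewrite mul_col_mx => /eqP.
rewrite col_mx_eq0 => /andP[/eqP Kc /eqP ec].
have c0 i : ~~ (d 0 i < 0) -> c i 0 = 0.
  by move=> hi; have /matrixP/(_ i 0) := ec; rewrite mul_diag_mx !mxE hi mul1r.
pose y := X *m P ^t* *m c.
have := Hpos y; rewrite /y mulmxA Kc => /(_ erefl).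
have -> : dotc y (H *m y) = dotc (P ^t* *m c) (G *m (P ^t* *m c)).
  by rewrite GE /y -!mulmxA dotcMl.
rewrite spectral_quad_form mulmxA PP mul1mx.
apply/negP; rewrite -real_ltNge ?real0 //; last first.
  by rewrite rpred_sum // => i _; rewrite rpredM // rpredX // normr_real.
have [i0 ci0] : exists i, c i 0 != 0.
  apply/existsP; apply: contraNT cN0; rewrite negb_exists => /forallP h.
  by apply/eqP/colP=> i; rewrite mxE; apply/eqP; rewrite -[_ == _]negbK h.
have di0 : d 0 i0 < 0 by apply: contraNT ci0 => /c0 ->.
rewrite (bigD1 i0) //= ltr_wnDr //.
  rewrite sumr_le0 // => i _; have [di|/c0 ->] := boolP (d 0 i < 0).
    by rewrite mulr_le0_ge0 ?(ltW di) ?exprn_ge0.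
  by rewrite normr0 expr0n mulr0.
by rewrite nmulr_rlt0 // exprn_gt0 // normr_gt0.
Qed.

Lemma trace_spectral : \tr G = \sum_i d 0 i.
Proof.
by rewrite /G mxtrace_mulC mulmxA PP mul1mx mxtrace_diag.
Qed.

Lemma trace_norm_le_rank c : 0 <= c -> (forall i, `|d 0 i| <= c) ->
  \sum_i `|d 0 i| <= (\rank G)%:R * c.
Proof.
move=> c0 hc; rewrite (bigID [pred i | d 0%R i != 0]) /= [X in _ + X]big1 ?addr0; last first.
  by move=> i; rewrite negbK => /eqP ->; rewrite normr0.
rewrite (le_trans (ler_sum _ (fun i _ => hc i))) // sumr_const mulr_natl.
by rewrite ler_wpMn2l // rank_spectral.
Qed.

(** The trace norm equals the trace plus twice the total modulus of the negative eigenvalues. The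
    trace costs a single [c], which accounts for the [+ 1] in the constant. *)
Lemma trace_norm_le_negative c r : 0 <= c -> (forall i, `|d 0 i| <= c) ->
  (#|[pred i | (d 0 i < 0)%R]| <= r)%N -> \tr G <= c ->
  \sum_i `|d 0 i| <= (2 * r + 1)%:R * c.
Proof.
move=> c0 hc hr; rewrite trace_spectral => htr.
have -> : \sum_i `|d 0 i| = \sum_i d 0 i + 2 * \sum_(i | d 0 i < 0) `|d 0 i|.
  rewrite mulr_sumr [X in _ + X]big_mkcond -big_split /=; apply: eq_bigr => i _.
  have := dreal i; rewrite realE => /orP[d0|d0].
    by rewrite ger0_norm // le_gtF ?addr0.
  rewrite ler0_norm //; have [_|] := boolP (d 0 i < 0); first by ring.
  by rewrite lt_neqAle d0 andbT negbK => /eqP ->; rewrite addr0 oppr0.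
have -> : (2 * r + 1)%:R * c = c + 2 * (r%:R * c) by ring.
rewrite lerD // ler_wpM2l ?ler0n //.
rewrite (le_trans (ler_sum _ (fun i _ => hc i))) // sumr_const mulr_natl.
by rewrite ler_wpMn2l.
Qed.
End SpectralSums.

(** * Inertia of a Hermitian involution *)

Lemma char_poly_similar (F : comNzRingType) n (Q P D : 'M[F]_n) :
  Q *m P = 1%:M -> char_poly (Q *m D *m P) = char_poly D.
Proof.
move=> QP; pose toP := @map_mx _ _ (@polyC F) n n.
have E : char_poly_mx (Q *m D *m P) = toP Q *m char_poly_mx D *m toP P.
  rewrite /char_poly_mx /toP mulmxBr mulmxBl -!map_mxM; congr (_ - _).
  by rewrite scalar_mxC -mulmxA -map_mxM QP map_mx1 mulmx1.
rewrite /char_poly E !det_mulmx mulrAC -det_mulmx -map_mxM QP map_mx1 det1.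
by rewrite mul1r.
Qed.

Section Involution.
Variables (C : numClosedFieldType) (n : nat) (J : 'M[C]_n) (r : seq C).
Hypotheses (hJ : J ^t* = J) (hJJ : J *m J = 1%:M).
Hypothesis hr : char_poly J = \prod_(z <- r) ('X - z%:P).

(** In an orthonormal eigenbasis [J] is diagonal with entries 1 and -1, so [1 - J] lives on the
    negative eigenspace and [1 + J] on the positive one. This turns the root counts defining the
    inertia into ranks of matrices that can serve as [K] in [negative_count]. *)
Lemma involution_ranks :
  (\rank (1%:M - J)%R <= count (fun z => z < 0)%R r)%N /\
  (\rank (1%:M + J)%R <= n - count (fun z => z < 0)%R r)%N.
Proof.
have [P [d PP [dr JE]]] := hermitian_spectral hJ.
have PP' : P ^t* *m P = 1%:M by exact: mulmx1C.
(* Two factorizations of the characteristic polynomial into monic linear factors agree up to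
   order. *)
have pr : perm_eq r [seq d 0 i | i <- enum 'I_n].
  apply: prod_XsubC_eq; rewrite -hr JE char_poly_similar // char_poly_trig.
    by rewrite big_map big_enum; apply: eq_bigr => i _; rewrite !mxE eqxx.
  by apply/is_trig_mxP => i j ij; rewrite mxE -val_eqE ltn_eqF.
have cntE : count (fun z => z < 0)%R r = #|[pred i | (d 0%R i < 0)%R]|.
  by rewrite (permP pr) count_map -size_filter cardE enumT; congr size.
have d2 i : d 0 i = 1 \/ d 0 i = -1.
  have : diag_mx d *m diag_mx d = 1%:M.
    transitivity (P *m (J *m J) *m P ^t*).
      by rewrite JE !mulmxA PP mul1mx -!mulmxA PP mulmx1 (mulmxA P) PP mul1mx.
    by rewrite hJJ mulmx1.
  move/matrixP/(_ i i); rewrite mul_diag_mx !mxE eqxx !mulr1n -expr2 => /eqP.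
  by rewrite sqrf_eq1 => /orP[]/eqP; [left|right].
have rk (a : C) : (\rank (1%:M + a *: J)%R <= #|[pred i | (1 + a * d 0%R i != 0)%R]|)%N.
  have -> : 1%:M + a *: J = P ^t* *m diag_mx (const_mx 1 + a *: d) *m P.
    rewrite linearD linearZ /= mulmxDr mulmxDl diag_const_mx mulmx1 PP'.
    by rewrite -scalemxAr -scalemxAl -JE.
  rewrite (leq_trans (mxrankM_maxl _ _)) // (leq_trans (mxrankM_maxr _ _)) //.
  rewrite (leq_trans (rank_diag_mx_le _)) //; apply: subset_leq_card.
  by apply/fintype.subsetP => i; rewrite !inE !mxE.
rewrite cntE; split.
  rewrite -[- J]scaleN1r (leq_trans (rk _)) //; apply: subset_leq_card.
  apply/fintype.subsetP => i; rewrite !inE; case: (d2 i) => ->.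
    by rewrite mulN1r subrr eqxx.
  by rewrite ltrN10.
rewrite -[X in 1%:M + X]scale1r (leq_trans (rk _)) //.
rewrite leq_subRL; last by rewrite -[n in (_ <= n)%N]card_ord max_card.
rewrite -[X in (_ <= X)%N]card_ord -(cardC [pred i | (d 0 i < 0)%R]) leq_add2l.
apply: subset_leq_card; apply/fintype.subsetP => i; rewrite !inE.
by case: (d2 i) => ->; rewrite ?mul1r ?subrr ?eqxx // ltr10.
Qed.
End Involution.

(** * Hankel forms on roots of unity *)

(** In characteristic zero ['X^N - 1] is separable, hence has [N] distinct roots; a field with that
    many [N]-th roots of unity contains a primitive one. *)
Lemma exists_prim_root (C : numClosedFieldType) N : (0 < N)%N ->
  exists w : C, N.-primitive_root w.
Proof.
move=> N0; have [r /= rE] := closed_field_poly_normal ('X^N - 1 : {poly C}).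
have mon : 'X^N - 1 \is @monic C by exact: (monicXnsubC 1).
rewrite (monicP mon) scale1r in rE.
have szr : size r = N.
  by have := size_XnsubC (1 : C) N0; rewrite rE size_prod_XsubC => -[].
have ur : uniq r.
  rewrite -separable_prod_XsubC -rE separable_Xn_sub_1 //.
  by rewrite pnatr_eq0 -lt0n.
have : has N.-primitive_root r.
  apply: has_prim_root => //; last by rewrite szr.
  by apply/allP=> z zr; rewrite /root_of_unity rE root_prod_XsubC.
by case/hasP => w _ hw; exists w.
Qed.

Section DFT.
Variables (C : numClosedFieldType) (N : nat) (w : C).
Hypothesis hw : N.-primitive_root w.
Let N0 : (0 < N)%N := prim_order_gt0 hw.

Lemma prim_root_norm : `|w| = 1.
Proof.
apply/eqP; rewrite -(@pexpr_eq1 _ _ N) // -normrX (prim_expr_order hw).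
by rewrite normr1.
Qed.

Lemma prim_root_conjX a : (a <= N)%N -> (w ^+ a)^* = w ^+ (N - a).
Proof.
move=> aN; have wN0 : w ^+ a != 0.
  by rewrite -normr_eq0 normrX prim_root_norm expr1n oner_eq0.
apply: (mulfI wN0); rewrite -normCK normrX prim_root_norm !expr1n.
by rewrite -exprD subnKC // prim_expr_order.
Qed.

Lemma prim_root_sum e :
  \sum_(l < N) (w ^+ l) ^+ e = if (N %| e)%N then N%:R else 0.
Proof.
under eq_bigr do rewrite -exprM mulnC exprM.
case: ifPn => [/dvdnP[c ->]|Ne].
  rewrite mulnC exprM (prim_expr_order hw) expr1n.
  under eq_bigr do rewrite expr1n.
  by rewrite sumr_const card_ord.
apply/eqP; have : (w ^+ e - 1) * \sum_(l < N) (w ^+ e) ^+ l == 0.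
  by rewrite -subrX1 -exprM mulnC exprM (prim_expr_order hw) expr1n subrr.
by rewrite mulf_eq0 subr_eq0 -(prim_order_dvd hw) (negPf Ne).
Qed.

(** Expanding the square, orthogonality of characters keeps only the diagonal. The condition
    [p <= N] prevents two indices from being congruent modulo [N]. *)
Lemma dft_parseval p (u : 'I_p -> C) : (p <= N)%N ->
  \sum_(l < N) `|\sum_a u a * (w ^+ l) ^+ a| ^+ 2 = N%:R * \sum_a `|u a| ^+ 2.
Proof.
move=> pN.
have E l : `|\sum_a u a * (w ^+ l) ^+ a| ^+ 2 =
    \sum_(a < p) \sum_(b < p) u a * (u b)^* * (w ^+ l) ^+ (a + (N - b)).
  rewrite normCK rmorph_sum /= mulr_suml; apply: eq_bigr => a _.
  rewrite mulr_sumr; apply: eq_bigr => b _.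
  have bN : (b <= N)%N by rewrite (leq_trans _ pN) // ltnW.
  have cj : ((w ^+ l) ^+ b)^* = (w ^+ l) ^+ (N - b).
    by rewrite exprAC rmorphXn /= prim_root_conjX // exprAC.
  by rewrite rmorphM /= cj exprD; ring.
under eq_bigr do rewrite E.
rewrite exchange_big /= mulr_sumr; apply: eq_bigr => a _.
rewrite exchange_big /=.
under eq_bigr do rewrite -mulr_sumr prim_root_sum.
have ap := leq_trans (ltn_ord a) pN.
rewrite (bigD1 a) //= subnKC ?(ltnW ap) // dvdnn normCK mulrC big1 ?addr0 // => b ba.
have bp := leq_trans (ltn_ord b) pN.
case: ifP; rewrite ?mulr0 // => /dvdnP[c hc]; exfalso; move: ba.
rewrite -val_eqE /= => /eqP; apply.
(* The exponent [a + (N - b)] lies strictly between 0 and [2 * N], so the only multiple of [N] it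
   can be is [N]. *)
have c1 : c = 1%N by case: c hc => [|[|c]]; lia.
by move: hc; rewrite c1; lia.
Qed.

(** On [N]-th roots of unity [z ^+ (N.-1 - i)] is the inverse of [z ^+ i.+1], so the inner sum is a
    truncated Laurent series at infinity with coefficients [h], written with natural exponents.
    Orthogonality extracts its [j]-th coefficient. *)
Lemma dft_inversion (h : nat -> C) j : (j < N)%N ->
  \sum_(l < N) (w ^+ l) ^+ j.+1 * (\sum_(i < N) (w ^+ l) ^+ (N.-1 - i) * h i)
  = N%:R * h j.
Proof.
move=> jN; under eq_bigr do rewrite mulr_sumr.
rewrite exchange_big /=.
have E (i : 'I_N) : \sum_(l < N) (w ^+ l) ^+ j.+1 * ((w ^+ l) ^+ (N.-1 - i) * h i) =
    (if (N %| j.+1 + (N.-1 - i))%N then N%:R else 0) * h i.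
  rewrite -prim_root_sum mulr_suml; apply: eq_bigr => l _.
  by rewrite mulrA -exprD.
under eq_bigr do rewrite E.
rewrite (bigD1 (Ordinal jN)) //= big1 ?addr0 => [|i ij].
  by rewrite (_ : _ + _ = N)%N ?dvdnn //; lia.
case: ifP; rewrite ?mul0r // => /dvdnP[c hc]; exfalso; move: ij.
rewrite -val_eqE /= => /eqP; apply; have iN := ltn_ord i.
have c1 : c = 1%N by case: c hc => [|[|c]]; lia.
by move: hc; rewrite c1; lia.
Qed.

(* Nehari's bound for the truncated Hankel form with (periodized) symbol [g]. *)
Lemma hankel_form_bound p (h : nat -> C) s (u : 'I_p -> C) : (2 * p <= N.+1)%N ->
  (forall l : 'I_N, `|\sum_(i < N) (w ^+ l) ^+ (N.-1 - i) * h i| <= s) ->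
  `|\sum_(a < p) \sum_(b < p) (u a)^* * h (a + b)%N * u b| <=
    s * \sum_a `|u a| ^+ 2.
Proof.
move=> pN hs; pose g l := \sum_(i < N) (w ^+ l) ^+ (N.-1 - i) * h i.
pose al l := \sum_a (u a)^* * (w ^+ l) ^+ a; pose be l := \sum_a u a * (w ^+ l) ^+ a.
have pN' : (p <= N)%N by lia.
(* The form becomes a sum over the roots of unity of the symbol against two transforms of [u].
   Inversion needs [a + b < N], which is what [2 * p <= N.+1] guarantees. *)
have key : N%:R * \sum_(a < p) \sum_(b < p) (u a)^* * h (a + b)%N * u b =
    \sum_(l < N) g l * w ^+ l * (al l * be l).
  have E l : g l * w ^+ l * (al l * be l) = \sum_(a < p) \sum_(b < p)
      (u a)^* * u b * ((w ^+ l) ^+ (a + b).+1 * g l).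
    rewrite /al mulr_suml mulr_sumr; apply: eq_bigr => a _.
    rewrite /be mulr_sumr mulr_sumr; apply: eq_bigr => b _.
    by rewrite exprS exprD; ring.
  under [RHS]eq_bigr do rewrite E.
  rewrite mulr_sumr [RHS]exchange_big; apply: eq_bigr => a _.
  rewrite mulr_sumr [RHS]exchange_big; apply: eq_bigr => b _ /=.
  have abN : (a + b < N)%N by have := ltn_ord a; have := ltn_ord b; lia.
  by rewrite -mulr_sumr /g dft_inversion //; ring.
have N1 : 0 < N%:R :> C by rewrite ltr0n.
rewrite -(ler_pM2l N1) -[X in X * `|_|](ger0_norm (ltW N1)) -normrM key.
have ale : \sum_(l < N) `|al l| ^+ 2 = N%:R * \sum_a `|u a| ^+ 2.
  rewrite (dft_parseval (fun a => (u a)^*) pN').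
  by congr (_ * _); apply: eq_bigr => a _; rewrite norm_conjC.
have bee : \sum_(l < N) `|be l| ^+ 2 = N%:R * \sum_a `|u a| ^+ 2.
  exact: dft_parseval.
have -> : N%:R * (s * \sum_a `|u a| ^+ 2) =
    \sum_(l < N) s * ((`|al l| ^+ 2 + `|be l| ^+ 2) / 2).
  by rewrite -mulr_sumr -mulr_suml big_split /= ale bee; field.
rewrite (le_trans (ler_norm_sum _ _ _)) // ler_sum // => l _.
rewrite normrM normrM normrX prim_root_norm expr1n mulr1.
rewrite ler_pM //; first exact: hs.
rewrite normrM ler_pdivlMr ?ltr0n // mulr_natr.
by have [] := real_leif_mean_square_scaled (normr_real (al l)) (normr_real (be l)).
Qed.
End DFT.

(** * Periodized moments of a J-selfadjoint matrix *)

Section PeriodizedMoments.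
Variables (C : numClosedFieldType) (n : nat) (J T W : 'M[C]_n.+1).
Hypotheses (hJ : J ^t* = J) (hJJ : J *m J = 1%:M).
Hypothesis hTJ : T ^t* *m J = J *m T.
Variables (s : C) (p : nat).
Hypotheses (s0 : 0 < s) (p0 : (0 < p)%N).
Hypothesis hres : forall z : C, `|z| = 1 -> forall y : 'cV[C]_n.+1,
  dotc y y <= s ^+ 2 * dotc (z *: y - T *m y) (z *: y - T *m y).
Hypothesis hW : (1%:M - T ^+ (2 * p)) *m W = 1%:M.
Hypothesis hsmall : forall y : 'cV[C]_n.+1,
  dotc (T ^+ (2 * p) *m y) (T ^+ (2 * p) *m y) <= dotc y y.

Lemma dotc_isometry x : dotc (J *m x) (J *m x) = dotc x x.
Proof. by rewrite dotcMl mulmxA hJ hJJ mul1mx. Qed.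

(** Here [y] is the resolvent of [T] at [z] applied to [v], given implicitly by its equation. As [J]
    is an isometry, [J *m y] inherits the bound [s] of [y]. *)
Lemma resolvent_form_le z y v : `|z| = 1 -> z *: y - T *m y = v ->
  `|dotc v (J *m y)| <= s * dotc v v.
Proof.
move=> z1 yv; apply: dotc_resolvent_le => //.
by rewrite dotc_isometry -yv hres.
Qed.

Lemma selfadjoint_power i : (T ^+ i) ^t* *m J = J *m T ^+ i.
Proof.
elim: i => [|i IH]; first by rewrite expr0 trmx1 map_mx1 mul1mx mulmx1.
rewrite exprS -mulmxE adjmxM -mulmxA hTJ mulmxA IH -mulmxA.
by congr (_ *m _); rewrite mulmxE -exprSr exprS.
Qed.

Lemma inverse_mull : W *m (1%:M - T ^+ (2 * p)) = 1%:M.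
Proof. exact: mulmx1C. Qed.

Lemma power_inverse_comm i : T ^+ i *m W = W *m T ^+ i.
Proof.
have cT : T ^+ i *m (1%:M - T ^+ (2 * p)) = (1%:M - T ^+ (2 * p)) *m T ^+ i.
  by rewrite mulmxBr mulmxBl mulmx1 mul1mx mulmxE -!exprD addnC.
rewrite -[LHS]mul1mx -{1}inverse_mull -mulmxA [X in W *m X]mulmxA -cT.
by rewrite -mulmxA hW mulmx1.
Qed.

Lemma inverse_selfadjoint : W ^t* *m J = J *m W.
Proof.
have cJ : (1%:M - T ^+ (2 * p)) ^t* *m J = J *m (1%:M - T ^+ (2 * p)).
  by rewrite linearB /= map_mxB mulmxBl selfadjoint_power trmx1 map_mx1 mul1mx mulmxBr mulmx1.
have E : W ^t* *m (1%:M - T ^+ (2 * p)) ^t* = 1%:M.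
  by rewrite -adjmxM hW trmx1 map_mx1.
by rewrite -[LHS]mulmx1 -hW mulmxA -[_ *m J *m _]mulmxA -cJ mulmxA E mul1mx.
Qed.

(** Formally the sum of [T ^+ (i + 2 * p * c)] over all natural numbers [c]. *)
Definition periodic_power i := T ^+ i *m W.

Lemma periodic_power_herm i :
  (J *m periodic_power i) ^t* = J *m periodic_power i.
Proof.
by rewrite /periodic_power !adjmxM hJ -mulmxA selfadjoint_power mulmxA inverse_selfadjoint power_inverse_comm mulmxA.
Qed.

Lemma inverse_herm : (J *m W) ^t* = J *m W.
Proof. by have := periodic_power_herm 0; rewrite /periodic_power expr0 mul1mx. Qed.

Section Vector.
Variable v : 'cV[C]_n.+1.
Definition moment i := dotc v (J *m (periodic_power i *m v)).
Definition hankel := \matrix_(a < p, b < p) moment (a + b).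
Definition krylov := \matrix_(r < n.+1, i < p) (T ^+ i *m v) r 0.

Lemma moment_real i : (moment i)^* = moment i.
Proof. by rewrite dotcC mulmxA dotcMl periodic_power_herm -mulmxA. Qed.

Lemma hankel_herm : hankel ^t* = hankel.
Proof. by apply/matrixP=> a b; rewrite adjmxE !mxE moment_real addnC. Qed.

Lemma col_krylov b : col b krylov = T ^+ b *m v.
Proof. by apply/colP=> i; rewrite !mxE. Qed.

(** J-selfadjointness moves [T ^+ a] to the left of [J]. Both the rank bound and the two eigenvalue
    counts are read off this factorization. *)
Lemma hankelE : hankel = krylov ^t* *m (J *m W) *m krylov.
Proof.
apply/matrixP=> a b; rewrite mxE.
have -> : (krylov ^t* *m (J *m W) *m krylov) a b =
    dotc (col a krylov) ((J *m W) *m col b krylov).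
  by rewrite /dotc tr_col map_row [col b _]colE !mulmxA -!row_mul -colE [RHS]mxE [RHS]mxE.
rewrite !col_krylov dotcMl /moment /periodic_power; congr dotc.
have -> : T ^+ (a + b) *m W = T ^+ a *m W *m T ^+ b.
  by rewrite exprD -mulmxE -mulmxA power_inverse_comm mulmxA.
by rewrite !mulmxA selfadjoint_power.
Qed.

(** Every power of [T] is a combination of the first [d] powers of [A], so all the columns lie in
    the span of the [d] vectors [A ^+ j *m v]. *)
Lemma krylov_rank (A : 'M[C]_n.+1) d :
  (forall i, (T ^+ i \in powers_mx A d)%MS) -> (\rank krylov <= d)%N.
Proof.
move=> hd; pose u i := mxvec (T ^+ i) *m pinvmx (powers_mx A d).
have uE i : T ^+ i = \sum_j u i 0 j *: A ^+ j.
  rewrite -[LHS]mxvecK -(mulmxKpV (hd i)) mulmx_sum_row linear_sum.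
  by apply: eq_bigr => j _; rewrite rowK linearZ /= mxvecK.
pose U := \matrix_(j < d, i < p) u i 0 j.
pose Y := \matrix_(r < n.+1, j < d) (A ^+ j *m v) r 0.
have -> : krylov = Y *m U.
  apply/matrixP=> r i; rewrite [LHS]mxE uE mulmx_suml summxE [RHS]mxE.
  by apply: eq_bigr => j _; rewrite -scalemxAl !mxE mulrC.
by rewrite (leq_trans (mxrankM_maxl _ _)) // rank_leq_col.
Qed.

(** Nehari's bound is applied with [N = 2 * p]: at each root of unity the symbol of the periodized
    moments is exactly a value of the resolvent form. *)
Lemma hankel_bound x : `|dotc x (hankel *m x)| <= s * dotc v v * dotc x x.
Proof.
have N0 : (0 < 2 * p)%N by lia.
have [w hw] := exists_prim_root C N0.
have -> : dotc x (hankel *m x) =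
    \sum_(a < p) \sum_(b < p) (x a 0)^* * moment (a + b) * x b 0.
  rewrite dotcE; apply: eq_bigr => a _; rewrite mxE mulr_sumr.
  by apply: eq_bigr => b _; rewrite mxE mulrA.
rewrite (dotc_self x).
apply: (@hankel_form_bound _ _ _ hw p moment (s * dotc v v)
  (fun a => x a 0)) => [|l].
  by lia.
pose z := w ^+ l.
have z1 : `|z| = 1 by rewrite normrX (prim_root_norm hw) expr1n.
pose y := \sum_(i < 2 * p) z ^+ ((2 * p).-1 - i) *: (periodic_power i *m v).
have -> : \sum_(i < 2 * p) z ^+ ((2 * p).-1 - i) * moment i = dotc v (J *m y).
  rewrite /y mulmx_sumr /dotc mulmx_sumr summxE; apply: eq_bigr => i _.
  by rewrite -!scalemxAr mxE.
apply: (resolvent_form_le z1).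
have cz : GRing.comm (z%:M : 'M[C]_n.+1) T.
  by rewrite /GRing.comm -!mulmxE scalar_mxC.
have yE : y = (\sum_(i < 2 * p) z%:M ^+ ((2 * p).-1 - i) * T ^+ i) *m (W *m v).
  rewrite mulmx_suml; apply: eq_bigr => i _.
  by rewrite -rmorphXn /= -mulmxE mul_scalar_mx -scalemxAl !mulmxA.
(* The product of [z - T] with the sum telescopes to [z ^+ (2 * p) - T ^+ (2 * p)], where the first
   power is 1; the factor [W] then cancels what remains. *)
have geo := subrXX_comm (2 * p) cz.
rewrite -mul_scalar_mx -mulmxBl yE (mulmxA (z%:M - T)) mulmxE -geo.
by rewrite -rmorphXn /= -exprM mulnC exprM (prim_expr_order hw) expr1n mulmxA hW mul1mx.
Qed.

Lemma hankel_trace_bound : `|\tr hankel| <= s * dotc v v.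
Proof.
(* The diagonal of [hankel] carries the even moments. The even period [2 * p] makes their sum
   telescope exactly, so [X] inverts [1 - T ^+ 2]. *)
pose X := \sum_(a < p) T ^+ (2 * a) *m W.
have hX : (1%:M - T ^+ 2) *m X = 1%:M.
  have geo : 1%:M - T ^+ (2 * p) = (1%:M - T ^+ 2) *m \sum_(a < p) T ^+ (2 * a).
    rewrite mulmxE exprM -[LHS]opprB -[1%:M]/(1 : 'M[C]_n.+1) subrX1 -mulNr opprB.
    by congr (_ * _); apply: eq_bigr => a _; rewrite exprM.
  by rewrite /X -mulmx_suml mulmxA -geo hW.
have -> : \tr hankel = dotc v (J *m (X *m v)).
  rewrite /mxtrace /X mulmx_suml mulmx_sumr /dotc mulmx_sumr summxE.
  by apply: eq_bigr => a _; rewrite mxE addnn -mul2n.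
(* These are the resolvents at 1 and at -1 applied to [v]; their difference is [2 *: (X *m v)]. *)
pose y1 := (1%:M + T) *m (X *m v); pose y2 := - ((1%:M - T) *m (X *m v)).
have h1 : 1 *: y1 - T *m y1 = v.
  rewrite scale1r -{1}[y1]mul1mx -mulmxBl /y1 !mulmxA.
  have -> : (1%:M - T) *m (1%:M + T) = 1%:M - T ^+ 2.
    by rewrite mulmxDr !mulmxBl !mulmx1 !mul1mx expr2 mulmxE addrA subrK.
  by rewrite hX mul1mx.
have h2 : (-1) *: y2 - T *m y2 = v.
  rewrite /y2 scaleN1r mulmxN !opprK -{1}[(1%:M - T) *m _]mul1mx -mulmxDl !mulmxA.
  have -> : (1%:M + T) *m (1%:M - T) = 1%:M - T ^+ 2.
    by rewrite mulmxBr !mulmxDl !mulmx1 !mul1mx expr2 mulmxE opprD addrA addrK.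
  by rewrite hX mul1mx.
have b1 := resolvent_form_le (normr1 _) h1.
have b2 := resolvent_form_le (normrN1 _) h2.
rewrite -(ler_pM2l (ltr0n C 2)) -[X in X * `|_|](ger0_norm (ler0n C 2)) -normrM.
have -> : 2 * dotc v (J *m (X *m v)) = dotc v (J *m y1) - dotc v (J *m y2).
  rewrite -dotcNr -dotcDr -mulmxN -mulmxDr /y2 opprK /y1 -mulmxDl.
  rewrite addrACA subrr addr0 mulmxDl mulmxDr dotcDr mul1mx; ring.
by rewrite (le_trans (ler_normB _ _)) // mulrDl !mul1r lerD.
Qed.

(** With [x = W *m y] the form is [dotc x x] minus [dotc (T ^+ (2 * p) *m x) x], and [T ^+ (2 * p)]
    is a contraction. Realness is a separate premise because [W] itself need not be Hermitian, only
    [J *m W] is. *)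
Lemma inverse_form_ge0 (y : 'cV[C]_n.+1) r : r \is Num.real ->
  r = dotc y (W *m y) -> 0 <= r.
Proof.
move=> rr rE; pose x := W *m y.
have yE : y = x - T ^+ (2 * p) *m x.
  by rewrite /x -{1}[W *m y]mul1mx -mulmxBl mulmxA hW mul1mx.
pose t := dotc (T ^+ (2 * p) *m x) x.
have rE' : r = dotc x x - t by rewrite rE -/x {1}yE dotcDl dotcNl.
have tr : t \is Num.real.
  have -> : t = dotc x x - r by rewrite rE'; ring.
  by rewrite rpredB // ger0_real // dotc_ge0.
have tl : `|t| <= 1 * dotc x x.
  rewrite /t -dotcC norm_conjC; apply: dotc_resolvent_le => //.
  by rewrite expr1n mul1r hsmall.
by rewrite rE' subr_ge0 (le_trans (real_ler_norm tr)) // -[leRHS]mul1r.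
Qed.

Lemma moment_bound (A : 'M[C]_n.+1) d k :
    (forall i, (T ^+ i \in powers_mx A d)%MS) -> (k < p)%N ->
  k.+1%:R * `|moment k| <= (minn d (minn (2 * \rank (1%:M - J)%R + 1)
    (2 * \rank (1%:M + J)%R + 1)))%:R * (s * dotc v v).
Proof.
move=> hd kp; have [P [dg PP [dr hE]]] := hermitian_spectral hankel_herm.
set c := s * dotc v v.
have c0 : 0 <= c by rewrite mulr_ge0 ?dotc_ge0 ?ltW.
have dc i : `|dg 0 i| <= c.
  by apply: (spectral_value_le PP) => x; rewrite -hE hankel_bound.
have Jr (y : 'cV[C]_n.+1) : dotc y (J *m W *m y) \is Num.real.
  by rewrite CrealE dotcC dotcMl inverse_herm.
(* The [k]-th antidiagonal is constant, and [k < p] ensures that all of its [k.+1] entries fit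
   inside the matrix. *)
have -> : k.+1%:R * `|moment k| =
    `|\sum_(a < p) \sum_(b < p) (a + b == k)%N%:R * hankel a b|.
  have E (a : 'I_p) : \sum_(b < p) (a + b == k)%N%:R * hankel a b =
      if (a < k.+1)%N then moment k else 0.
    case: ifPn => ak; last first.
      rewrite big1 // => b _; rewrite (_ : (_ == _)%N = false) ?mul0r //.
      by apply/eqP; lia.
    have kap : (k - a < p)%N by lia.
    rewrite (bigD1 (Ordinal kap)) //= subnKC // eqxx mul1r big1 ?addr0.
      by rewrite mxE /= subnKC.
    move=> b; rewrite -val_eqE /= => hb.
    by rewrite (_ : (_ == _)%N = false) ?mul0r //; apply/eqP; move/eqP: hb; lia.
  under eq_bigr do rewrite E.
  rewrite -big_mkcond -(big_ord_widen _ (fun=> moment k) kp) sumr_const card_ord.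
  by rewrite normrMn mulr_natl.
rewrite {1}hE; apply: le_trans (antidiag_sum_le dg PP k) _.
have nm a b e : (minn a (minn b e) = a \/ minn a (minn b e) = b \/
    minn a (minn b e) = e)%N by lia.
set r1 := (X in minn d (minn X _)); set r2 := (X in minn d (minn _ X)).
(* The three cases bound the trace norm through the rank, the negative eigenvalues, and the positive
   eigenvalues. *)
have [->|[->|->]] := nm d r1 r2; rewrite {}/r1 {}/r2.
- apply: le_trans (trace_norm_le_rank PP c0 dc) _.
  rewrite ler_wpM2r // ler_nat -hE hankelE.
  by rewrite (leq_trans (mxrankM_maxr _ _)) // (krylov_rank hd).
- apply: (trace_norm_le_negative PP dr c0 dc).
    apply: (negative_count PP dr (H := J *m W) (X := krylov)).
      by rewrite -hE hankelE.
    (* On the kernel of [1 - J] one has [J *m y = y], so the form of [J *m W] reduces to that of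
       [W]. *)
    move=> y; rewrite mulmxBl mul1mx => /eqP; rewrite subr_eq0 => /eqP yJ.
    apply: (inverse_form_ge0 (y := y)) => //.
    by rewrite -mulmxA {1}yJ dotcMl hJ mulmxA hJJ mul1mx.
  have tr : \tr hankel \is Num.real.
    by rewrite hE (trace_spectral _ PP) rpred_sum.
  by rewrite -hE (le_trans (real_ler_norm tr)) // hankel_trace_bound.
(* Positive eigenvalues are counted as the negative ones of [- hankel]; now [J *m y = - y] on the
   kernel of [1 + J]. *)
- have hE' : - hankel = P ^t* *m diag_mx (- dg) *m P.
    by rewrite hE linearN /= mulmxN mulNmx.
  have dr' i : (- dg) 0 i \is Num.real by rewrite mxE rpredN.
  have dc' i : `|(- dg) 0 i| <= c by rewrite mxE normrN.
  have -> : \sum_i `|dg 0 i| = \sum_i `|(- dg) 0 i|.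
    by apply: eq_bigr => i _; rewrite mxE normrN.
  apply: (trace_norm_le_negative PP dr' c0 dc').
    apply: (negative_count PP dr' (H := - (J *m W)) (X := krylov)).
      by rewrite -hE' hankelE mulmxN mulNmx.
    move=> y; rewrite mulmxDl mul1mx => /eqP; rewrite addr_eq0 => /eqP yJ.
    apply: (inverse_form_ge0 (y := y)).
      by rewrite mulNmx dotcNr rpredN.
    rewrite mulNmx dotcNr -mulmxA {1}yJ dotcNl opprK.
    by rewrite dotcMl hJ (mulmxA J J) hJJ mul1mx.
  have tr : - \tr hankel \is Num.real.
    by rewrite hE (trace_spectral _ PP) rpredN rpred_sum.
  by rewrite -hE' linearN /= (le_trans (real_ler_norm tr)) // normrN hankel_trace_bound.
Qed.
End Vector.
End PeriodizedMoments.

(** * Norms over the complex numbers *)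

Local Open Scope classical_set_scope.
Local Open Scope complex_scope.
Local Open Scope ring_scope.

Section Norms.
Variable R : realType.
Local Notation C := R[i].

Lemma cabsE (z : C) : (cabs z)%:C = `|z|.
Proof. by []. Qed.

Lemma cabs_ge0 (z : C) : 0 <= cabs z.
Proof. by rewrite -lecR cabsE; exact: normr_ge0. Qed.

Lemma cabsM (z w : C) : cabs (z * w) = cabs z * cabs w.
Proof. exact: Normc.normcM. Qed.

Lemma cabs_real (a : R) : cabs a%:C = `|a|.
Proof. by rewrite /cabs /= expr0n addr0 sqrtr_sqr. Qed.

Lemma vnorm2_ge0 n (x : 'cV[C]_n) : 0 <= vnorm2 x.
Proof. exact: sqrtr_ge0. Qed.

Lemma vnorm2_sqr n (x : 'cV[C]_n) : (vnorm2 x ^+ 2)%:C = dotc x x.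
Proof.
rewrite sqr_sqrtr ?sumr_ge0 // => [|i _]; last by rewrite exprn_ge0 ?cabs_ge0.
by rewrite dotc_self rmorph_sum; apply: eq_bigr => i _; rewrite rmorphXn.
Qed.

Lemma vnorm2_le_dotc n m (x : 'cV[C]_n) (y : 'cV[C]_m) (c : R) : 0 <= c ->
  (vnorm2 x <= c * vnorm2 y) = (dotc x x <= c%:C ^+ 2 * dotc y y).
Proof.
move=> c0; rewrite -!vnorm2_sqr -rmorphXn -rmorphM lecR -exprMn.
by rewrite ler_sqr ?nnegrE ?mulr_ge0 ?vnorm2_ge0.
Qed.

Lemma vnorm2_eq0 n (x : 'cV[C]_n) : (vnorm2 x == 0) = (x == 0).
Proof.
apply/eqP/eqP => [h|->]; last first.
  by rewrite /vnorm2 big1 ?sqrtr0 // => i _; rewrite mxE /cabs Normc.normc0 expr0n.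
have : dotc x x == 0 by rewrite -vnorm2_sqr h expr0n.
rewrite dotc_self psumr_eq0 => [/allP hx|i _]; last by rewrite exprn_ge0.
apply/colP=> i; have := hx i (mem_index_enum i).
by rewrite /= sqrf_eq0 normr_eq0 mxE => /eqP.
Qed.

Lemma vnorm2_0 n : vnorm2 (0 : 'cV[C]_n) = 0.
Proof. by apply/eqP; rewrite vnorm2_eq0. Qed.

Lemma vnorm2_gt0 n (x : 'cV[C]_n) : (0 < vnorm2 x) = (x != 0).
Proof. by rewrite lt_neqAle eq_sym vnorm2_eq0 vnorm2_ge0 andbT. Qed.

Lemma vnorm2Z n (a : C) (x : 'cV[C]_n) : vnorm2 (a *: x) = cabs a * vnorm2 x.
Proof.
apply/eqP; rewrite -(@eqrXn2 _ 2) ?mulr_ge0 ?vnorm2_ge0 ?cabs_ge0 //.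
apply/eqP/complexI; rewrite vnorm2_sqr dotcZl dotcZr mulrA -normCKC exprMn.
by rewrite [RHS](rmorphM (real_complex R)) /= vnorm2_sqr -cabsE -rmorphXn.
Qed.

Lemma dotc_cauchy n (x y : 'cV[C]_n) : `|dotc x y| <= (vnorm2 x * vnorm2 y)%:C.
Proof.
have [->|x0] := eqVneq x 0.
  by rewrite -[0 : 'cV[C]_n](scale0r 0) dotcZl conjC0 mul0r normr0 lecR mulr_ge0 ?vnorm2_ge0.
have [->|y0] := eqVneq y 0.
  by rewrite -[0 : 'cV[C]_n](scale0r 0) dotcZr mul0r normr0 lecR mulr_ge0 ?vnorm2_ge0.
have [a0 b0] : 0 < vnorm2 x /\ 0 < vnorm2 y by rewrite !vnorm2_gt0.
(* The ratio of the norms is the optimal weight: it makes the two terms of [dotc_le] equal. *)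
have t0 : 0 < (vnorm2 y / vnorm2 x)%:C :> C by rewrite ltcR divr_gt0.
apply: le_trans (dotc_le x y t0) _; rewrite -!vnorm2_sqr -fmorphV -!rmorphM -rmorphD /=.
have -> : 2 = (2 : R)%:C :> C by rewrite rmorph_nat.
rewrite -fmorphV -rmorphM lecR le_eqVlt; apply/orP; left; apply/eqP; field.
by rewrite !gt_eqF.
Qed.

Lemma vnorm2D n (x y : 'cV[C]_n) : vnorm2 (x + y) <= vnorm2 x + vnorm2 y.
Proof.
rewrite -ler_sqr ?nnegrE ?addr_ge0 ?vnorm2_ge0 // -lecR vnorm2_sqr.
rewrite !(dotcDl, dotcDr).
have rr : dotc x y + dotc y x \is Num.real by rewrite CrealE rmorphD /= !dotcC addrC.
pose c := vnorm2 x * vnorm2 y.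
have h : dotc x y + dotc y x <= (c + c)%:C.
  apply: le_trans (real_ler_norm rr) _; apply: le_trans (ler_normD _ _) _.
  rewrite -[`|dotc y x|]norm_conjC dotcC rmorphD /=.
  by rewrite lerD // dotc_cauchy.
have -> : ((vnorm2 x + vnorm2 y) ^+ 2)%:C = dotc x x + (c + c)%:C + dotc y y.
  by rewrite -!vnorm2_sqr -!rmorphD; congr (_%:C); rewrite /c; ring.
have -> : dotc x x + dotc x y + (dotc y x + dotc y y) =
   dotc x x + (dotc x y + dotc y x) + dotc y y by ring.
by rewrite lerD2r lerD2l.
Qed.

Lemma vnorm2N n (x : 'cV[C]_n) : vnorm2 (- x) = vnorm2 x.
Proof.
by rewrite -scaleN1r vnorm2Z -[-1](rmorphN1 (real_complex R)) cabs_real normrN1 mul1r.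
Qed.

Lemma vnorm2_sum n (I : finType) (F : I -> 'cV[C]_n) :
  vnorm2 (\sum_i F i) <= \sum_i vnorm2 (F i).
Proof.
elim/big_ind2: _ => //; last by move=> x a y b ha hb; rewrite (le_trans (vnorm2D _ _)) ?lerD.
by rewrite le_eqVlt vnorm2_eq0 eqxx.
Qed.

Definition op_le m n (M : 'M[C]_(m, n)) c :=
  forall x, vnorm2 (M *m x) <= c * vnorm2 x.

(** The sum of the column norms is a crude bound, but it shows that the set defining [spectral_norm]
    is bounded above, so that its supremum is an upper bound. *)
Lemma op_le_ex m n (M : 'M[C]_(m, n)) : exists2 c, 0 <= c & op_le M c.
Proof.
exists (\sum_j vnorm2 (col j M)) => [|x]; first by rewrite sumr_ge0 // => j _; exact: vnorm2_ge0.
have -> : M *m x = \sum_j x j 0 *: col j M.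
  by apply/colP=> i; rewrite mxE summxE; apply: eq_bigr => j _; rewrite !mxE mulrC.
rewrite (le_trans (vnorm2_sum _)) // mulr_suml ler_sum // => j _.
rewrite vnorm2Z mulrC ler_wpM2l ?vnorm2_ge0 //.
rewrite -ler_sqr ?nnegrE ?vnorm2_ge0 ?cabs_ge0 // -lecR vnorm2_sqr dotc_self.
by rewrite rmorphXn /= (bigD1 j) //= cabsE lerDl sumr_ge0.
Qed.

Lemma op_leW m n (M : 'M[C]_(m, n)) a b : a <= b -> op_le M a -> op_le M b.
Proof. by move=> ab h x; rewrite (le_trans (h x)) // ler_wpM2r // vnorm2_ge0. Qed.

Lemma spectral_norm_le m n (M : 'M[C]_(m, n)) c : 0 <= c -> op_le M c ->
  spectral_norm M <= c.
Proof.
move=> c0 h; apply: ge_sup.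
  by exists (vnorm2 (M *m 0)), 0 => //=; rewrite vnorm2_0.
move=> _ [x /= hx <-]; rewrite (le_trans (h x)) // -[leRHS]mulr1 ler_wpM2l //.
Qed.

Lemma op_le_spectral_norm m n (M : 'M[C]_(m, n)) : op_le M (spectral_norm M).
Proof.
have [c c0 hc] := op_le_ex M; move=> x.
have [->|x0] := eqVneq x 0.
  by rewrite mulmx0 !vnorm2_0 mulr0.
have a0 : 0 < vnorm2 x by rewrite vnorm2_gt0.
rewrite -ler_pdivrMr //.
pose t := ((vnorm2 x)^-1)%:C : C.
have -> : vnorm2 (M *m x) / vnorm2 x = vnorm2 (M *m (t *: x)).
  by rewrite -scalemxAr vnorm2Z cabs_real gtr0_norm ?invr_gt0 // mulrC.
apply: ub_le_sup.
  exists c => _ [y /= hy <-]; rewrite (le_trans (hc y)) // -[leRHS]mulr1.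
  by rewrite ler_wpM2l.
exists (t *: x) => //=.
by rewrite vnorm2Z cabs_real gtr0_norm ?invr_gt0 // mulVf ?gt_eqF.
Qed.

Lemma spectral_norm_ge0 m n (M : 'M[C]_(m, n)) : 0 <= spectral_norm M.
Proof.
have [c c0 hc] := op_le_ex M; apply: ub_le_sup.
  exists c => _ [y /= hy <-]; rewrite (le_trans (hc y)) // -[leRHS]mulr1.
  by rewrite ler_wpM2l.
by exists 0; rewrite /= ?mulmx0 vnorm2_0.
Qed.
End Norms.

(** * Decay of powers and the Kreiss constant *)

Section Decay.
Variables (R : realType) (n : nat) (T : 'M[R[i]]_n.+1).

(** The right factor [B] lets the linear factors of the characteristic polynomial be removed one at
    a time. *)
Definition decays (B : 'M[R[i]]_n.+1) :=
  forall e : R, 0 < e -> exists N, forall j, (N <= j)%N -> op_le (T ^+ j *m B) e.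

(** Each new power is [z] times the previous one plus a term that tends to 0 by assumption, a
    contracting recursion with vanishing perturbation. *)
Lemma decays_peel (B : 'M[R[i]]_n.+1) z : cabs z < 1 ->
  decays ((T - z%:M) *m B) -> decays B.
Proof.
move=> z1 hC e e0; set r := cabs z in z1.
have r0 : 0 <= r by exact: cabs_ge0.
(* With perturbations of this size the recursion has fixed point [e / 2], leaving the other half of
   [e] for the geometric term. *)
have d0 : 0 < e * (1 - r) / 2 by rewrite divr_gt0 ?mulr_gt0 ?subr_gt0.
have [N0 hN0] := hC _ d0.
have [c c0 hc] := op_le_ex (T ^+ N0 *m B).
have step i : op_le (T ^+ (N0 + i) *m B) (r ^+ i * c + e / 2).
  elim: i => [|i IH].
    rewrite addn0 expr0 mul1r; apply: op_leW hc.
    by rewrite lerDl divr_ge0 ?(ltW e0).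
  have -> : T ^+ (N0 + i.+1) *m B =
      z *: (T ^+ (N0 + i) *m B) + T ^+ (N0 + i) *m ((T - z%:M) *m B).
    rewrite mulmxBl mulmxBr mul_scalar_mx -scalemxAr addrC subrK.
    by rewrite addnS exprSr -mulmxE mulmxA.
  move=> x; rewrite mulmxDl (le_trans (vnorm2D _ _)) //.
  rewrite -scalemxAl vnorm2Z -/r.
  have h1 := IH x; have h2 := hN0 (N0 + i)%N (leq_addr _ _) x.
  apply: (le_trans (lerD (ler_wpM2l r0 h1) h2)).
  by rewrite le_eqVlt; apply/orP; left; apply/eqP; rewrite exprS; field.
have c1 : 0 < c + 1 by rewrite ltr_wpDl.
have e1 : 0 < e / 2 / (c + 1) by rewrite !divr_gt0.
have r1 : `|r| < 1 by rewrite ger0_norm.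
have /cvgr0Pnorm_lt/(_ _ e1)[N1 _ hN1] := cvg_expr r1.
exists (N0 + N1)%N => j hj.
have -> : j = (N0 + (j - N0))%N by lia.
apply: op_leW (step _).
have := hN1 (j - N0)%N; rewrite /= => /(_ _)/ltW h.
have {}h : r ^+ (j - N0) <= e / 2 / (c + 1).
  by rewrite -(ger0_norm (exprn_ge0 _ r0)) h //; lia.
rewrite [leRHS](splitr e) lerD2r.
apply: (@le_trans _ _ (e / 2 / (c + 1) * (c + 1))); last by rewrite divfK ?gt_eqF.
by apply: ler_pM; rewrite ?exprn_ge0 ?lerDl ?ler01.
Qed.

Lemma decays_prod (s : seq R[i]) (B : 'M[R[i]]_n.+1) :
  (forall z, z \in s -> cabs z < 1) ->
  decays ((\prod_(z <- s) (T - z%:M)) *m B) -> decays B.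
Proof.
elim: s B => [|z s IH] B hs; first by rewrite big_nil mul1mx.
rewrite big_cons -mulmxE -mulmxA => /decays_peel h.
apply: IH => [w ws|]; first by rewrite hs // inE ws orbT.
by apply: h; rewrite hs // mem_head.
Qed.

Lemma char_poly_eigenvalues : char_poly T = \prod_(z <- eigenvalues_seq T) ('X - z%:P).
Proof.
rewrite /eigenvalues_seq; case: closed_field_poly_normal => s /= {1}->.
by rewrite (monicP (char_poly_monic T)) scale1r.
Qed.

(** By Cayley-Hamilton the product of all the factors [T - z%:M] is 0, which decays trivially;
    peeling the factors off leaves the identity. *)
Lemma power_decay : (forall z, eigenvalue T z -> cabs z < 1) ->
  forall e : R, 0 < e -> exists N, forall j, (N <= j)%N -> op_le (T ^+ j) e.
Proof.
move=> hT; have : decays 1%:M.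
  apply: (@decays_prod (eigenvalues_seq T)) => [z zs|].
    by apply: hT; rewrite eigenvalue_root_char char_poly_eigenvalues root_prod_XsubC.
  have := Cayley_Hamilton T; rewrite char_poly_eigenvalues rmorph_prod /=.
  under eq_bigr do rewrite rmorphB /= horner_mx_X horner_mx_C.
  move=> -> e e0; exists 0%N => j _ x.
  by rewrite mul0mx mulmx0 mul0mx vnorm2_0 mulr_ge0 ?vnorm2_ge0 ?ltW.
by move=> h e /h[N hN]; exists N => j /hN; rewrite mulmx1.
Qed.
End Decay.

Section Kreiss.
Variables (R : realType) (n : nat) (A : 'M[R[i]]_n.+1) (gamma : R).
Hypothesis hspec : forall z, eigenvalue A z -> cabs z < gamma.

Lemma gamma_gt0 : 0 < gamma.
Proof.
have [z /hspec] := eigenvalue_closed A (ltn0Sn n).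
exact/le_lt_trans/cabs_ge0.
Qed.

Lemma scaled_power c i : (c%:C *: A) ^+ i = (c ^+ i)%:C *: A ^+ i.
Proof. by rewrite exprZn rmorphXn. Qed.

Lemma scaled_decay c : gamma <= c -> forall e : R, 0 < e ->
  exists N, forall j, (N <= j)%N -> op_le ((c^-1%:C *: A) ^+ j) e.
Proof.
move=> gc; have c0 := lt_le_trans gamma_gt0 gc.
have cN0 : c%:C != 0 :> R[i] by rewrite fmorph_eq0 gt_eqF.
apply: power_decay => z /eigenvalueP[v vT vN0].
have /hspec : eigenvalue A (c%:C * z).
  apply/eigenvalueP; exists v => //.
  rewrite -scalerA -vT -scalemxAr scalerA fmorphV mulfV // scale1r //.
rewrite cabsM cabs_real gtr0_norm // => h.
by rewrite -(ltr_pM2l c0) mulr1 (lt_le_trans h).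
Qed.

Lemma resolvent_unit z : gamma < cabs z -> z%:M - A \in unitmx.
Proof.
move=> hz; rewrite -opprB -scaleN1r unitmxZ ?unitrN1 //.
rewrite -row_free_unit -kermx_eq0; apply/negPn/negP => /hspec.
by rewrite ltNge ltW.
Qed.

(** This makes the set defining [kreiss_const] bounded above, so that its supremum is an upper
    bound. Some power of [A / gamma] has norm at most 1/2, and a finite expansion of the resolvent
    up to that power absorbs its own remainder. *)
Lemma resolvent_bound : exists B, forall z, gamma < cabs z ->
  op_le (invmx (z%:M - A)) (B / (cabs z - gamma)).
Proof.
have h2 : 0 < 2^-1 :> R by rewrite invr_gt0.
have [N hN] := scaled_decay (lexx _) h2.
pose T := gamma^-1%:C *: A; pose c i := spectral_norm (T ^+ i).
pose S := \sum_(i < N.+1) c i.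
have g0 := gamma_gt0.
have c0 i : 0 <= c i by exact: spectral_norm_ge0.
have S0 : 0 <= S by rewrite sumr_ge0.
have AT i : A ^+ i = (gamma ^+ i)%:C *: T ^+ i.
  rewrite scaled_power scalerA -rmorphM -exprMn mulfV ?gt_eqF // expr1n.
  by rewrite scale1r.
exists (2 * S) => z hz y; set x := invmx _ *m y.
have z0 := lt_trans g0 hz.
have yE : y = (z%:M - A) *m x by rewrite /x mulKVmx // resolvent_unit.
have cz : GRing.comm (z%:M : 'M[R[i]]_n.+1) A by rewrite /GRing.comm -!mulmxE scalar_mxC.
(* The identity factoring [z ^+ N.+1 - A ^+ N.+1] through [z - A], applied to [x]. *)
have xE : z ^+ N.+1 *: x = A ^+ N.+1 *m x +
    \sum_(i < N.+1) z ^+ (N.+1.-1 - i) *: (A ^+ i *m y).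
  have cz' : GRing.comm (z%:M - A) (\sum_(i < N.+1) z%:M ^+ (N.+1.-1 - i) * A ^+ i).
    apply: commr_sum => i _; apply: commrM; apply: commrX.
      by apply/commr_sym/commrB => //; exact/commr_sym.
    by apply/commr_sym/commrB => //; exact/commr_sym.
  have -> : \sum_(i < N.+1) z ^+ (N.+1.-1 - i) *: (A ^+ i *m y) =
      (\sum_(i < N.+1) z%:M ^+ (N.+1.-1 - i) * A ^+ i) *m y.
    rewrite mulmx_suml; apply: eq_bigr => i _.
    by rewrite -rmorphXn /= -mulmxE mul_scalar_mx -scalemxAl.
  rewrite {1}yE mulmxA mulmxE -cz' -subrXX_comm // mulmxBl addrC subrK.
  by rewrite -rmorphXn /= mul_scalar_mx.
have key : cabs z ^+ N.+1 * vnorm2 x <=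
   cabs z ^+ N.+1 * (2^-1 * vnorm2 x) + cabs z ^+ N * (S * vnorm2 y).
  have -> : cabs z ^+ N.+1 * vnorm2 x = vnorm2 (z ^+ N.+1 *: x).
    rewrite vnorm2Z; congr (_ * _); apply: complexI.
    by rewrite rmorphXn /= !cabsE normrX.
  rewrite xE (le_trans (vnorm2D _ _)) // lerD //.
    rewrite AT -scalemxAl vnorm2Z cabs_real ger0_norm ?exprn_ge0 ?(ltW g0) //.
    rewrite ler_pM ?exprn_ge0 ?vnorm2_ge0 ?(ltW g0) //.
      by rewrite lerXn2r ?nnegrE ?(ltW g0) ?(ltW z0) ?ltW.
    exact: hN.
  rewrite (le_trans (vnorm2_sum _)) // /S mulr_suml mulr_sumr ler_sum // => i _.
  rewrite AT vnorm2Z -scalemxAl vnorm2Z cabs_real ger0_norm ?exprn_ge0 ?(ltW g0) //.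
  rewrite mulrA ler_pM ?vnorm2_ge0 ?mulr_ge0 ?cabs_ge0 ?exprn_ge0 ?(ltW g0) //.
    have -> : cabs (z ^+ (N - i)) = cabs z ^+ (N - i).
      by apply: complexI; rewrite rmorphXn /= !cabsE normrX.
    have -> : cabs z ^+ N = cabs z ^+ (N - i) * cabs z ^+ i.
      by rewrite -exprD subnK // -ltnS.
    rewrite ler_wpM2l ?exprn_ge0 ?cabs_ge0 //.
    by rewrite lerXn2r ?nnegrE ?(ltW g0) ?(ltW z0) ?ltW.
  exact: op_le_spectral_norm.
have key2 : cabs z * vnorm2 x <= 2 * S * vnorm2 y.
  have zN : 0 < cabs z ^+ N by rewrite exprn_gt0.
  rewrite -(ler_pM2l zN); move: key; rewrite exprS; nra.
rewrite mulrAC ler_pdivlMr ?subr_gt0 // mulrC (le_trans _ key2) //.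
by rewrite ler_wpM2r ?vnorm2_ge0 // gerBl ltW.
Qed.

Lemma op_le_kreiss z : gamma < cabs z ->
  op_le (invmx (z%:M - A)) (kreiss_const gamma A / (cabs z - gamma)).
Proof.
move=> hz; apply: op_leW (op_le_spectral_norm _).
rewrite ler_pdivlMr ?subr_gt0 // mulrC; apply: ub_le_sup; last by exists z.
have [B hB] := resolvent_bound.
have B0 : 0 <= B.
  have := hB _ hz (delta_mx 0 0); set a := vnorm2 _; set b := vnorm2 _ => h.
  have b0 : 0 < b.
    rewrite vnorm2_gt0; apply/negP => /eqP/matrixP/(_ 0 0).
    by rewrite !mxE !eqxx => /eqP; rewrite oner_eq0.
  have : 0 <= B / (cabs z - gamma) * b by rewrite (le_trans _ h) ?vnorm2_ge0.
  by rewrite pmulr_lge0 // pmulr_lge0 // invr_gt0 subr_gt0.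
exists B => _ [w /= hw <-].
rewrite mulrC -ler_pdivlMr ?subr_gt0 //.
by apply: spectral_norm_le (hB _ hw); rewrite divr_ge0 // subr_ge0 ltW.
Qed.

(** The resolvent at [gamma + 1] takes the nonzero value [x], so the bound of [op_le_kreiss] there
    cannot be nonpositive. *)
Lemma kreiss_const_gt0 : 0 < kreiss_const gamma A.
Proof.
have hz : gamma < cabs (gamma + 1)%:C.
  by rewrite cabs_real ger0_norm ?ltrDl // addr_ge0 ?(ltW gamma_gt0).
set z := (gamma + 1)%:C in hz.
pose x : 'cV[R[i]]_n.+1 := delta_mx 0 0.
have x0 : 0 < vnorm2 x.
  rewrite vnorm2_gt0; apply/negP => /eqP/matrixP/(_ 0 0).
  by rewrite !mxE !eqxx => /eqP; rewrite oner_eq0.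
have := op_le_kreiss hz ((z%:M - A) *m x).
rewrite mulKmx ?resolvent_unit // => /(lt_le_trans x0) h.
have c0 : 0 < kreiss_const gamma A / (cabs z - gamma).
  have [//|le0] := ltP 0 (kreiss_const gamma A / (cabs z - gamma)).
  by have := lt_le_trans h (mulr_le0_ge0 le0 (vnorm2_ge0 _)); rewrite ltxx.
by move: c0; rewrite pmulr_lgt0 // invr_gt0 subr_gt0.
Qed.

(** Scaling by [r] carries the unit circle to the circle of radius [r], where the Kreiss constant
    controls the resolvent of [A]. *)
Lemma circle_resolvent_bound (r : R) : gamma < r ->
  forall z, cabs z = 1 -> forall y, vnorm2 y <=
    r * kreiss_const gamma A / (r - gamma) * vnorm2 (z *: y - (r^-1%:C *: A) *m y).
Proof.
move=> hr z z1 y; have r0 := lt_trans gamma_gt0 hr.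
have rzE : cabs (r%:C * z) = r by rewrite cabsM z1 mulr1 cabs_real gtr0_norm.
have hrz : gamma < cabs (r%:C * z) by rewrite rzE.
pose w := z *: y - (r^-1%:C *: A) *m y.
have wE : r%:C *: w = ((r%:C * z)%:M - A) *m y.
  rewrite /w scalerBr scalerA mulmxBl mul_scalar_mx -scalemxAl scalerA -rmorphM.
  by rewrite mulfV ?gt_eqF // scale1r.
have := op_le_kreiss hrz (r%:C *: w).
rewrite {1}wE mulKmx ?resolvent_unit // vnorm2Z cabs_real gtr0_norm // rzE.
rewrite -/w => h; apply: le_trans h _.
set K := kreiss_const _ _; set d := (r - gamma)^-1; set v := vnorm2 w.
by have -> : K * d * (r * v) = r * K * d * v by ring.
Qed.

Lemma scaled_power_mem c i :
  ((c *: A) ^+ i \in powers_mx A (degree_mxminpoly A))%MS.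
Proof.
have -> : (c *: A) ^+ i = horner_mx A ((c *: 'X) ^+ i).
  by rewrite rmorphXn /= linearZ /= horner_mx_X.
exact: horner_mx_mem.
Qed.
End Kreiss.

(** * Removing the periodization *)

Lemma op_le_approx (R : realType) m n (M : 'M[R[i]]_(m, n)) (c : R) : 0 <= c ->
  (forall e, 0 < e -> op_le M (c * (1 + e))) -> op_le M c.
Proof.
move=> c0 h x; apply/ler_addgt0Pr => e e0.
have d0 : 0 < c * vnorm2 x + 1 by rewrite ltr_wpDl ?mulr_ge0 ?vnorm2_ge0.
have := h (e / (c * vnorm2 x + 1)) (divr_gt0 e0 d0) x.
move/le_trans; apply; rewrite mulrAC mulrDr mulr1 lerD2l mulrA ler_pdivrMr //.
by rewrite mulrC ler_wpM2l ?(ltW e0) // lerDl.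
Qed.

Lemma periodic_inverse_exists (R : realType) n (E : 'M[R[i]]_n.+1) e :
  e < 1 -> op_le E e -> exists W, (1%:M - E) *m W = 1%:M.
Proof.
move=> e1 hE; exists (invmx (1%:M - E)); apply: mulmxV.
rewrite -row_full_unit /row_full eqn_leq rank_leq_col /= leqNgt.
apply/negP => /exists_kernel_col[x x0] /eqP.
rewrite mulmxBl mul1mx subr_eq0 => /eqP xE.
have := hE x; rewrite -xE leNgt -subr_gt0 => /negP; apply.
by rewrite -[X in X - _]mul1r -mulrBl mulr_gt0 ?subr_gt0 ?vnorm2_gt0.
Qed.

(** The moment bound controls the quadratic form of the Hermitian matrix [J *m T ^+ k *m W], hence
    its operator norm. Since [T ^+ (2 * p)] can be made arbitrarily small, replacing [W] by the
    identity costs a factor [1 + e] for any positive [e]. *)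
Lemma op_le_normalized_power (R : realType) (n : nat) (J T A : 'M[R[i]]_n.+1) (s : R) d k :
  J ^t* = J -> J *m J = 1%:M -> T ^t* *m J = J *m T ->
  0 < s ->
  (forall z : R[i], cabs z = 1 -> forall y : 'cV_n.+1,
     vnorm2 y <= s * vnorm2 (z *: y - T *m y)) ->
  (forall e : R, 0 < e -> exists N, forall j, (N <= j)%N -> op_le (T ^+ j) e) ->
  (forall i, (T ^+ i \in powers_mx A d)%MS) -> (0 < d)%N ->
  op_le (T ^+ k) ((minn d (minn (2 * \rank (1%:M - J)%R + 1)
    (2 * \rank (1%:M + J)%R + 1)))%:R * s / k.+1%:R).
Proof.
move=> hJ hJJ hTJ s0 hres hdec hd d0.
set nu := minn _ _; have nu0 : (0 < nu)%N by rewrite /nu; lia.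
set c := nu%:R * s / k.+1%:R.
have c0 : 0 < c by rewrite divr_gt0 ?mulr_gt0 ?ltr0n.
apply: op_le_approx (ltW c0) _ => e e0.
pose e' := Num.min e (2^-1).
have e'0 : 0 < e' by rewrite lt_min e0 invr_gt0 ltr0n.
have e'1 : e' < 1 by rewrite gt_min invf_lt1 ?ltr0n // ltr1n orbT.
have [N hN] := hdec _ e'0.
(* Large enough both for [T ^+ (2 * p)] to be small and for the [k]-th antidiagonal to fit. *)
pose p := (N + k).+1.
have hE : op_le (T ^+ (2 * p)) e' by apply: hN; rewrite /p; lia.
have [W hW] := periodic_inverse_exists e'1 hE.
have sC0 : 0 < s%:C :> R[i] by rewrite ltcR.
have hresC (z : R[i]) : `|z| = 1 -> forall y : 'cV[R[i]]_n.+1,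
    dotc y y <= s%:C ^+ 2 * dotc (z *: y - T *m y) (z *: y - T *m y).
  move=> z1 y; rewrite -vnorm2_le_dotc ?(ltW s0) //; apply: hres.
  by apply: complexI; rewrite cabsE z1.
have hsm (y : 'cV[R[i]]_n.+1) : dotc (T ^+ (2 * p) *m y) (T ^+ (2 * p) *m y) <= dotc y y.
  have := @vnorm2_le_dotc _ _ _ (T ^+ (2 * p) *m y) y _ ler01.
  rewrite expr1n !mul1r => <-.
  by rewrite (le_trans (hE y)) // -[leRHS]mul1r ler_wpM2r ?vnorm2_ge0 ?ltW.
have kp : (k < p)%N by rewrite /p; lia.
have p0 : (0 < p)%N by [].
have core v := moment_bound hJ hJJ hTJ sC0 p0 hresC hW hsm v hd kp.
have cC0 : 0 < c%:C :> R[i] by rewrite ltcR.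
have hH := periodic_power_herm hJ hTJ hW k.
have hb x : vnorm2 (T ^+ k *m W *m x) <= c * vnorm2 x.
  rewrite vnorm2_le_dotc ?(ltW c0) // -(dotc_isometry hJ hJJ) mulmxA.
  apply: hermitian_form_bound => // v.
  have := core v; rewrite /moment -/nu => h.
  have k0 : 0 < k.+1%:R :> R[i] by rewrite ltr0n.
  rewrite -(ler_pM2l k0) -mulmxA (le_trans h) // le_eqVlt; apply/orP; left.
  rewrite mulrA mulrA; apply/eqP; congr (_ * _).
  rewrite /c !rmorphM fmorphV !rmorph_nat /=.
  by rewrite mulrCA mulfV ?gt_eqF // mulr1.
move=> x; pose y := x - T ^+ (2 * p) *m x.
(* The vector [y] undoes [W], and its norm is at most [1 + e] times that of [x]. *)
have -> : T ^+ k *m x = T ^+ k *m W *m y.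
  rewrite /y -{2}[x]mul1mx -mulmxBl mulmxA -(mulmxA (T ^+ k)).
  by rewrite (mulmx1C hW) mulmx1.
rewrite (le_trans (hb y)) // -mulrA ler_wpM2l ?(ltW c0) //.
rewrite /y (le_trans (vnorm2D _ _)) // vnorm2N mulrDl mul1r lerD2l.
by rewrite (le_trans (hE x)) // ler_wpM2r ?vnorm2_ge0 // ge_min lexx.
Qed.


Theorem corollary6p1 (R : realType) (n q : nat) (J A : 'M[R[i]]_n.+1)
    (gamma : R)
    (hJadj : J = J ^t*)
    (hJunit : J \in unitmx)
    (hJinv : J = invmx J)
    (hJinertia : inertia J = ((n.+1 - q)%N, q))
    (hAJ : A ^t* *m J = J *m A)
    (hAspec : spectrum A `<=` [set z : R[i] | cabs z <= 1])
    (hrho : spectral_radius A < gamma)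
    (hgamma : gamma < 1)
    (k : nat) (hk : (1 <= k)%N) :
  spectral_norm (A ^+ k) <=
    (nuJ J A)%:R * (1 + k%:R^-1) ^+ k * kreiss_const gamma A * gamma ^+ k
  /\
  (nuJ J A)%:R * (1 + k%:R^-1) ^+ k * kreiss_const gamma A * gamma ^+ k <=
    expR 1 * (nuJ J A)%:R * kreiss_const gamma A * gamma ^+ k.
Proof.
(* [hAspec] bounds the set of moduli, so its supremum [spectral_radius A] dominates each of them. *)
have hspec z : eigenvalue A z -> cabs z < gamma.
  move=> Az; apply: le_lt_trans hrho; apply: ub_le_sup; last by exists z.
  by exists 1 => _ [w /hAspec hw <-].
have g0 := gamma_gt0 hspec; have K0 := kreiss_const_gt0 hspec.
set K := kreiss_const gamma A in K0 *.
have k0 : 0 < k%:R :> R by rewrite ltr0n.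
have ik0 : 0 < k%:R^-1 :> R by rewrite invr_gt0.
split; last first.
  rewrite ler_wpM2r ?exprn_ge0 ?(ltW g0) // ler_wpM2r ?(ltW K0) //.
  (* The inequality [1 + x <= expR x] at [x = k%:R^-1], raised to the power [k]. *)
  rewrite mulrC ler_wpM2r // (@le_trans _ _ (expR k%:R^-1 ^+ k)) //.
    by rewrite lerXn2r ?nnegrE ?expR_ge0 ?expR_ge1Dx // addr_ge0 ?ltW.
  by rewrite -expRM_natr mulVf ?gt_eqF.
have hJJ : J *m J = 1%:M by rewrite {2}hJinv mulmxV.
have hJ : J ^t* = J by rewrite -hJadj.
pose r := gamma * (1 + k%:R^-1).
have gr : gamma < r by rewrite /r mulrDr mulr1 ltrDl mulr_gt0.
have r0 := lt_trans g0 gr.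
pose T := r^-1%:C *: A.
have hTJ : T ^t* *m J = J *m T.
  rewrite /T linearZ /= map_mxZ /= -scalemxAl hAJ -scalemxAr.
  by rewrite conj_Creal ?complex_real.
(* With this radius the resolvent constant carries exactly the factor [k.+1] that the antidiagonal
   pairing divides out, while [r ^+ k] supplies [(1 + k%:R^-1) ^+ k]. *)
have sE : r * K / (r - gamma) = k.+1%:R * K.
  have -> : r - gamma = gamma / k%:R by rewrite /r mulrDr mulr1 addrAC subrr add0r.
  by rewrite /r -natr1; field; rewrite !gt_eqF.
have := circle_resolvent_bound hspec gr; rewrite -/K sE -/T => hres.
have s0 : 0 < k.+1%:R * K by rewrite mulr_gt0 ?ltr0n.
have hd i : (T ^+ i \in powers_mx A (degree_mxminpoly A))%MS.
  exact: scaled_power_mem.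
have := op_le_normalized_power k hJ hJJ hTJ s0 hres (scaled_decay hspec (ltW gr))
  hd (mxminpoly_nonconstant A).
set nu := minn _ _ => hT.
have {}hT : op_le (T ^+ k) ((nuJ J A)%:R * K).
  apply: op_leW hT; rewrite mulrCA mulrAC mulfV ?mul1r; last first.
    by rewrite pnatr_eq0.
  rewrite ler_wpM2r ?(ltW K0) // ler_nat /nu /nuJ.
  have mono a b c d e : (a <= c -> b <= e -> minn d (minn (2 * a + 1) (2 * b + 1)) <=
      minn d (minn (2 * c + 1) (2 * e + 1)))%N by lia.
  by have [] := involution_ranks hJ hJJ (char_poly_eigenvalues J); exact: mono.
have -> : A ^+ k = (r ^+ k)%:C *: T ^+ k.
  rewrite scaled_power scalerA -rmorphM -exprMn mulfV ?gt_eqF // expr1n.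
  by rewrite scale1r.
have rk0 : 0 <= r ^+ k by rewrite exprn_ge0 ?ltW.
have -> : (nuJ J A)%:R * (1 + k%:R^-1) ^+ k * K * gamma ^+ k =
    r ^+ k * ((nuJ J A)%:R * K).
  by rewrite /r exprMn; ring.
apply: spectral_norm_le => [|x].
  by rewrite !mulr_ge0 // ltW.
by rewrite -scalemxAl vnorm2Z cabs_real ger0_norm // -mulrA ler_wpM2l.
Qed.
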